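(* Let $G$ be a strongly topological gyrogroup with a symmetric neighborhood base $\mathscr U$ at $0$ and let $H$ be a locally compact metrizable admissible subgyrogroup of $G$ generated from $\mathscr U$. If the quotient space $G/H$ is a stratifiable space (respectively, a semi-stratifiable space, a $\sigma$-space), then $G$ is a local stratifiable space (respectively, a local semi-stratifiable space, a local $\sigma$-space).
   Context: All topological spaces are assumed to be Hausdorff. A gyrogroup is a set $G$ with a binary operation $\oplus$ such that: (G1) there is a unique identity element $0\in G$ with $0\oplus a=a=a\oplus 0$ for all $a\in G$; (G2) for each $x\in G$ there is a unique inverse $\ominus x\in G$ with $\ominus x\oplus x=0=x\oplus(\ominus x)$; (G3) for all $x,y\in G$ there is an automorphism $\mathrm{gyr}[x,y]$ of $(G,\oplus)$ with $x\oplus(y\oplus z)=(x\oplus y)\oplus \mathrm{gyr}[x,y](z)$ for all $z\in G$; (G4) $\mathrm{gyr}[x\oplus y,y]=\mathrm{gyr}[x,y]$ for all $x,y\in G$. A topological gyrogroup is a gyrogroup with a topology such that $\oplus:G\times G\to G$ is jointly continuous and $x\mapsto\ominus x$ is continuous. A strongly topological gyrogroup with a symmetric neighborhood base $\mathscr U$ at $0$ is a topological gyrogroup $G$ together with a neighborhood base $\mathscr U$ of $0$ such that for every $U\in\mathscr U$: $\ominus U=U$ and $\mathrm{gyr}[x,y](U)=U$ for all $x,y\in G$. A subgyrogroup of $G$ is a nonempty subset $H$ with $\ominus a\in H$ and $a\oplus b\in H$ for all $a,b\in H$; it is an $L$-subgyrogroup if moreover $\mathrm{gyr}[a,h](H)=H$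 for all $a\in G$, $h\in H$. A subgyrogroup $H$ of $G$ is an admissible subgyrogroup generated from $\mathscr U$ if there is a sequence $\{U_n:n\in\omega\}$ of open symmetric neighborhoods of $0$ with each $U_n\in\mathscr U$, $U_{n+1}\oplus(U_{n+1}\oplus U_{n+1})\subset U_n$ for each $n\in\omega$, and $H=\bigcap_{n\in\omega}U_n$. Such an $H$ is known to be a closed $L$-subgyrogroup of $G$. For an $L$-subgyrogroup $H$, the set $G/H=\{a\oplus H:a\in G\}$ is a partition of $G$; it carries the quotient topology with respect to $\pi:G\to G/H$, $\pi(a)=a\oplus H$ (i.e. $O\subset G/H$ is open iff $\pi^{-1}(O)$ is open in $G$). Subsets such as $H$ carry the subspace topology. A space $(X,\tau)$ is semi-stratifiable if there is a function $S:\mathbb N\times\tau\to\{\text{closed subsets of }X\}$ such that (a) $U=\bigcup_{n=1}^\infty S(n,U)$ for each $U\in\tau$; (b) if $U,V\in\tau$ and $U\subset V$ then $S(n,U)\subset S(n,V)$ for each $n\in\mathbb N$. It is stratifiable if such an $S$ can be chosen so that in addition $U=\bigcup_{n=1}^\infty [S(n,U)]^\circ$ for each $U\in\tau$, where $^\circ$ denotes interior. A $\sigma$-space is a regular space with a $\sigma$-discrete network, where a network for $X$ is a family $\mathcal N$ of subsets of $X$ such that whenever $x\in U$ with $U$ open there is $N\in\mathcal N$ with $x\in N\subset U$. A space is a local stratifiable (semi-stratifiable, $\sigma$-) space if every point has a neighborhood which, as a subspace, is a stratifiable (semi-stratifiable, $\sigma$-) space. *)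

(* Defs.v *)
From HB Require Import structures.
From mathcomp Require Import all_boot all_order all_algebra.
From mathcomp Require Import generic_quotient.
From mathcomp Require Import all_classical all_reals all_analysis.

Set Implicit Arguments.
Unset Strict Implicit.
Unset Printing Implicit Defensive.

Local Open Scope classical_set_scope.

Declare Scope gyro_scope.
Delimit Scope gyro_scope with gyro.

(* The gyrations are part of the data; they are determined by the operation,
   gyr[x, y] z = ⊖ (x ⊕ y) ⊕ (x ⊕ (y ⊕ z)). *)
HB.mixin Record isGyrogroup (G : Type) := {
  gyroadd : G -> G -> G;
  gyrozero : G;
  gyroopp : G -> G;
  gyr : G -> G -> G -> G;
  gyroadd0l : forall a, gyroadd gyrozero a = a;
  gyroadd0r : forall a, gyroadd a gyrozero = a;
  gyrozero_uniq : forall e,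
    (forall a, gyroadd e a = a /\ gyroadd a e = a) -> e = gyrozero;
  gyroaddNl : forall x, gyroadd (gyroopp x) x = gyrozero;
  gyroaddNr : forall x, gyroadd x (gyroopp x) = gyrozero;
  gyroopp_uniq : forall x y,
    gyroadd y x = gyrozero -> gyroadd x y = gyrozero -> y = gyroopp x;
  gyr_bij : forall x y, bijective (gyr x y);
  gyr_morph : forall x y,
    {morph gyr x y : a b / gyroadd a b >-> gyroadd a b};
  gyroaddA : forall x y z,
    gyroadd x (gyroadd y z) = gyroadd (gyroadd x y) (gyr x y z);
  gyr_loop : forall x y, gyr (gyroadd x y) y =1 gyr x y
}.

#[short(type="gyrogroupType")]
HB.structure Definition Gyrogroup := {G of isGyrogroup G & Choice G}.

Notation "x ⊕ y" := (gyroadd x y) (at level 50, left associativity) : gyro_scope.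
Notation "⊖ x" := (gyroopp x) (at level 35, right associativity) : gyro_scope.
Notation "'gyr[' x , y ]" := (gyr x y) (at level 0, format "'gyr[' x ,  y ]") : gyro_scope.
Local Open Scope gyro_scope.

HB.mixin Record Gyrogroup_isTopological (G : Type)
    & Topological G & isGyrogroup G := {
  gyroadd_continuous : continuous (fun xy : G * G => xy.1 ⊕ xy.2);
  gyroopp_continuous : continuous (fun x : G => ⊖ x)
}.

#[short(type="topologicalGyrogroupType")]
HB.structure Definition TopologicalGyrogroup :=
  {G of Topological G & Gyrogroup G & Gyrogroup_isTopological G}.

Definition set_gyroadd (G : gyrogroupType) (A B : set G) : set G :=
  [set a ⊕ b | a in A & b in B].

Definition symmetric_set (G : gyrogroupType) (A : set G) : Prop :=
  [set ⊖ a | a in A] = A.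

Definition subgyrogroup (G : gyrogroupType) (H : set G) : Prop :=
  [/\ H !=set0,
      forall a, H a -> H (⊖ a)
    & forall a b, H a -> H b -> H (a ⊕ b)].

Definition strongly_topological (G : topologicalGyrogroupType)
    (UU : set (set G)) : Prop :=
  [/\ forall U, UU U -> nbhs (gyrozero : G) U,
      forall V, nbhs (gyrozero : G) V -> exists2 U, UU U & U `<=` V,
      forall U, UU U -> symmetric_set U
    & forall U, UU U -> forall x y : G, gyr[x, y] @` U = U].

Definition admissible_subgyrogroup (G : topologicalGyrogroupType)
    (UU : set (set G)) (H : set G) : Prop :=
  subgyrogroup H /\
  exists U : nat -> set G,
    [/\ forall n, open_nbhs (gyrozero : G) (U n) /\ symmetric_set (U n),
        forall n, UU (U n),
        forall n, set_gyroadd (U n.+1) (set_gyroadd (U n.+1) (U n.+1)) `<=` U n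
      & H = \bigcap_n U n].

(* G/H = {a ⊕ H : a in G} is presented as the quotient of G by equality of left
   cosets, so that its points correspond to the distinct sets a ⊕ H. *)
Section gyrocoset_space.
Local Open Scope quotient_scope.
Context (G : topologicalGyrogroupType) (H : set G).

Definition gyrocoset (a : G) : set G := [set a ⊕ h | h in H].

Definition gyrocoset_rel : rel G := fun a b => `[< gyrocoset a = gyrocoset b >].

Lemma gyrocoset_rel_refl : reflexive gyrocoset_rel.
Proof. by move=> a; apply/asboolP. Qed.

Lemma gyrocoset_rel_sym : symmetric gyrocoset_rel.
Proof.
by move=> a b; apply/idP/idP => /asboolP ab; apply/asboolP; rewrite ab.
Qed.

Lemma gyrocoset_rel_trans : transitive gyrocoset_rel.
Proof.
by move=> b a c /asboolP ab /asboolP bc; apply/asboolP; rewrite ab.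
Qed.

Canonical gyrocoset_equiv :=
  EquivRel gyrocoset_rel gyrocoset_rel_refl gyrocoset_rel_sym gyrocoset_rel_trans.

Definition gyrocoset_space := {eq_quot gyrocoset_equiv}.

HB.instance Definition _ := Quotient.on gyrocoset_space.
HB.instance Definition _ :=
  Topological.copy gyrocoset_space (quotient_topology gyrocoset_space).

End gyrocoset_space.

Definition metrizable (R : realType) (T : topologicalType) : Prop :=
  exists (M : metricType R) (f : T -> M) (g : M -> T),
    [/\ cancel f g, cancel g f, continuous f & continuous g].

(* In the three classes below, spaces are Hausdorff by convention. *)

(* S is only constrained on open sets; its other values are irrelevant. *)
Definition semi_stratification (T : topologicalType)
    (S : nat -> set T -> set T) : Prop :=
  [/\ forall n U, open U -> closed (S n U),
      forall U, open U -> U = \bigcup_n S n U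
    & forall n U V, open U -> open V -> U `<=` V -> S n U `<=` S n V].

Definition semi_stratifiable_space (T : topologicalType) : Prop :=
  hausdorff_space T /\ exists S, @semi_stratification T S.

Definition stratifiable_space (T : topologicalType) : Prop :=
  hausdorff_space T /\
  exists2 S, @semi_stratification T S &
    forall U : set T, open U -> U = \bigcup_n (S n U)°.

Definition network (T : topologicalType) (N : set (set T)) : Prop :=
  forall (x : T) (U : set T), open U -> U x ->
    exists2 A, N A & A x /\ A `<=` U.

Definition discrete_family (T : topologicalType) (F : set (set T)) : Prop :=
  forall x : T, exists2 V, nbhs x V &
    forall A B, F A -> F B -> A `&` V !=set0 -> B `&` V !=set0 -> A = B.

Definition sigma_discrete (T : topologicalType) (N : set (set T)) : Prop :=
  exists2 F : nat -> set (set T),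
    (forall n, discrete_family (F n)) & N = \bigcup_n F n.

Definition sigma_space (T : topologicalType) : Prop :=
  [/\ hausdorff_space T, @regular_space T
    & exists2 N : set (set T), network N & sigma_discrete N].

(* [set_type V] carries the subspace topology. *)
Definition local_space (P : topologicalType -> Prop) (T : topologicalType) : Prop :=
  forall x : T, exists2 V : set T, nbhs x V & P (set_type V).

(* Main.v *)
(* Choose V_n in UU with V_{n+1} ⊕ V_{n+1} ⊂ V_n and trivial intersection, which
   is possible because H = ⋂ U_n and H is first countable; as the V_n are
   symmetric and gyration-invariant, the relations ⊖ x ⊕ y ∈ V_n form a countable
   base E of a uniformity coarser than the topology of G.  Since H is locally
   compact, the projection π : G -> G/H behaves on a small neighborhood F of any
   point like a perfect map, so that E and π together generate the topology of F:
   in effect F embeds into the product of a pseudometrizable space and G/H.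
   Each of the three classes is inherited by such an F from G/H.  For (semi-)
   stratifiability, let P_k(x, U) be the largest open set of G/H with
   E_k[x] ∩ π^{-1} P_k(x, U) ⊂ U, and stratify U by the closures of
   {x | π x ∈ S_n (P_k(x, U))}.  For σ-spaces, intersect preimages of members of
   the network of G/H with the members of Stone's σ-discrete refinements of the
   covers {E_k[z]}. *)

Require Import Defs.
From HB Require Import structures.
From mathcomp Require Import all_boot all_order all_algebra.
From mathcomp Require Import all_classical all_reals all_analysis.
From mathcomp Require wochoice.

Set Implicit Arguments.
Unset Strict Implicit.
Unset Printing Implicit Defensive.

Local Open Scope classical_set_scope.

(** * Countable bases of uniformities *)

(* The uniform topology of [E] may be strictly coarser than that of [X]. *)
Definition uniformity_sequence (X : topologicalType) (E : nat -> X -> set X) :=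
  [/\ forall n x, nbhs x (E n x),
      forall n x y, E n x y -> E n y x
    & forall n x y z, E n.+1 x y -> E n.+1 y z -> E n x z].

Definition jointly_generates (X Y : topologicalType) (f : X -> Y)
    (E : nat -> X -> set X) :=
  forall x U, nbhs x U ->
    exists n P, [/\ open P, P (f x) & E n x `&` f @^-1` P `<=` U].

Section UniformitySequence.
Context (X : topologicalType) (E : nat -> X -> set X).
Hypothesis unifE : uniformity_sequence E.

Lemma uniformity_nbhs n x : nbhs x (E n x).
Proof. by case: unifE. Qed.

Lemma uniformity_refl n x : E n x x.
Proof. exact: nbhs_singleton (uniformity_nbhs n x). Qed.

Lemma uniformity_sym n x y : E n x y -> E n y x.
Proof. by case: unifE => _ + _; exact. Qed.

Lemma uniformity_split n x y z : E n.+1 x y -> E n.+1 y z -> E n x z.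
Proof. by case: unifE => _ _; exact. Qed.

Lemma uniformity_le m n x : (m <= n)%N -> E n x `<=` E m x.
Proof.
elim: n => [|n IHn]; first by rewrite leqn0 => /eqP ->.
rewrite leq_eqVlt ltnS => /orP[/eqP -> //|/IHn En y Exy].
by apply/En/(uniformity_split Exy)/uniformity_refl.
Qed.

End UniformitySequence.

(** * Pulling generalized metric properties back along a jointly generating map *)

Section Transfer.
Context (X Y : topologicalType) (f : X -> Y) (E : nat -> X -> set X).
Hypothesis unifE : uniformity_sequence E.
Hypothesis contf : continuous f.
Hypothesis genX : jointly_generates f E.

(** This is the set P_k(x, U) of the overview. *)
Let slice k x (U : set X) : set Y :=
  \bigcup_(P in [set P | open P /\ E k x `&` f @^-1` P `<=` U]) P.

Let slice_open k x U : open (slice k x U).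
Proof. by apply: bigcup_open => P []. Qed.

Let slice_mono k x U V : U `<=` V -> slice k x U `<=` slice k x V.
Proof.
move=> UV y [P [oP PU] Py]; exists P => //; split => //.
exact: subset_trans PU UV.
Qed.

Let slice_sub k x U : slice k x U (f x) -> U x.
Proof.
by move=> [P [_ PU] Pfx]; apply: PU; split => //; exact: uniformity_refl.
Qed.

(** The smaller ball [E k.+1 x'] lies inside [E k x], so each [P] that works for [x] at level [k]
    works for [x'] one level finer. *)
Let slice_near k x x' U : E k.+1 x x' -> slice k x U `<=` slice k.+1 x' U.
Proof.
move=> xx' y [P [oP PU] Py]; exists P => //; split => // z [x'z Pz].
by apply: PU; split => //; exact: (uniformity_split unifE) xx' x'z.
Qed.

Let slice_ex x U : open U -> U x -> exists k, slice k x U (f x).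
Proof.
move=> oU Ux; have [k [P [oP Pfx PU]]] := genX (open_nbhs_nbhs (conj oU Ux)).
by exists k, P.
Qed.

(** Lets a single index run through all pairs (k, n). The default at indices that code no pair only
    repeats (0, 0). *)
Let decode (j : nat) : nat * nat := odflt (0, 0)%N (unpickle j).

Let decodeK p : decode (pickle p) = p.
Proof. by rewrite /decode pickleK. Qed.

Let strat (S : nat -> set Y -> set Y) (j : nat) (U : set X) : set X :=
  closure [set x | S (decode j).2 (slice (decode j).1 x U) (f x)].

Lemma strat_semi S : semi_stratification S -> semi_stratification (strat S).
Proof.
move=> [Scl SU Smono]; split=> [n U _|U oU|n U V oU oV UV].
- exact: closed_closure.
- apply/seteqP; split=> [x Ux|x [j _]].
    have [k kx] := slice_ex oU Ux.
    have := kx; rewrite [X in X (f x)](SU _ (slice_open k x U)) => -[n _ Sn].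
    exists (pickle (k, n)) => //; apply: subset_closure => /=.
    by rewrite decodeK.
  rewrite /strat; case: (decode j) => k n /= clx.
  (* One level finer, the slice at [x] contains the level-[k] slices of all points near [x]. So
     [S n] of this one slice, a closed set, captures [f x] as a limit. *)
  apply: (@slice_sub k.+1).
  suff : S n (slice k.+1 x U) (f x).
    by move=> Sx; rewrite (SU _ (slice_open k.+1 x U)); exists n.
  have clC : closed (S n (slice k.+1 x U)) by apply/Scl/slice_open.
  apply: clC => B /contf xB.
  have [x' /= [Sx' [xx' Bx']]] :=
    clx _ (filterI (uniformity_nbhs unifE k.+1 x) xB).
  exists (f x'); split => //.
  apply: (Smono n (slice k x' U)) (Sx'); try exact: slice_open.
  exact: slice_near (uniformity_sym unifE xx').
- apply: closureS => x /=; apply: Smono; try exact: slice_open.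
  exact: slice_mono.
Qed.

Lemma semi_stratifiable_transfer :
  hausdorff_space X -> semi_stratifiable_space Y -> semi_stratifiable_space X.
Proof.
by move=> hX [_ [S sS]]; split => //; exists (strat S); exact: strat_semi.
Qed.

Lemma stratifiable_transfer :
  hausdorff_space X -> stratifiable_space Y -> stratifiable_space X.
Proof.
move=> hX [_ [S sS Sint]]; split => //; exists (strat S).
  exact: strat_semi.
move=> U oU; apply/seteqP; split=> [x Ux|x [j _ /interior_subset Sx]]; last first.
  have [_ SU _] := strat_semi sS.
  by rewrite (SU _ oU); exists j.
have [k kx] := slice_ex oU Ux.
have := kx; rewrite [X in X (f x)](Sint _ (slice_open k x U)) => -[n _ Sn].
(* Level [k.+1] rather than [k]: the slice at [x] then sits inside those of all nearby [x'], which
   gives a whole neighbourhood of [x] even before the closure is taken. *)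
exists (pickle (k.+1, n)) => //; rewrite /interior /strat decodeK /=.
have fS : nbhs x (f @^-1` S n (slice k x U)) by apply: contf.
apply: filterS (filterI (uniformity_nbhs unifE k.+1 x) fS).
move=> x' [xx' Sx']; apply: subset_closure => /=.
case: sS => _ _ Smono; apply: (Smono n (slice k x U)) (Sx'); try exact: slice_open.
exact: slice_near.
Qed.

Lemma regular_transfer : @regular_space Y -> @regular_space X.
Proof.
move=> regY x U /genX[n [P [oP Pfx PU]]].
have [Q Qfx QP] := regY _ _ (open_nbhs_nbhs (conj oP Pfx)).
exists (E n.+1 x `&` f @^-1` Q).
  by apply: filterI; [exact: uniformity_nbhs | exact: contf].
move=> y cly; apply: PU; split.
  have [z [[xz _] yz]] := cly _ (uniformity_nbhs unifE n.+1 y).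
  exact: (uniformity_split unifE) xz (uniformity_sym unifE yz).
apply: QP => B /contf yB; have [z [[_ Qz] Bz]] := cly _ yB.
by exists (f z).
Qed.

(* Stone's refinement of the cover of [X] by the sets [E k z], for a well-order
   [R]: [z] is the first centre such that [E k z] contains a ball around [y]. *)
Let well_inside k z y := exists m, E m y `<=` E k z.

Let stone (R : rel X) k m z : set X :=
  [set y | E m y `<=` E k z /\ forall z', well_inside k z' y -> R z z'].

Let stone_cover (R : rel X) k y :
  wochoice.well_order R -> exists m z, stone R k m z y.
Proof.
move=> woR; have wy : well_inside k y y by exists k.
have [|z [[+ zmin] _]] := woR [pred z | `[< well_inside k z y >]].
  by exists y; rewrite inE.
rewrite inE => -[m mz]; exists m, z; split => // z' kz'.
by apply: zmin; rewrite inE.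
Qed.

(** Since [y] and [y'] are close, the ball of level [m.+1] around either lies in the level-[m] ball
    of the other. Each centre therefore competes at the other's point, and minimality works both
    ways. *)
Let stone_separated (R : rel X) k m z z' y y' : wochoice.well_order R ->
  stone R k m z y -> stone R k m z' y' -> E m.+1 y y' -> z = z'.
Proof.
move=> woR [yz zmin] [y'z' z'min] yy'.
have zz' : R z z'.
  apply: zmin; exists m.+1 => u yu; apply: y'z'.
  exact: (uniformity_split unifE) (uniformity_sym unifE yy') yu.
have z'z : R z' z.
  apply: z'min; exists m.+1 => u yu; apply: yz.
  exact: (uniformity_split unifE) yy' yu.
have Ranti := wochoice.wo_chain_antisymmetric (@wochoice.withinW _ predT _ woR).
by apply: Ranti; rewrite ?inE // zz'.
Qed.

Lemma sigma_transfer : hausdorff_space X -> sigma_space Y -> sigma_space X.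
Proof.
move=> hX [_ regY [N netN [F discF NF]]].
split=> //; first exact: regular_transfer.
have [R woR] := wochoice.well_ordering_principle X.
pose D (j : nat) : nat * nat * nat := odflt (0, 0, 0)%N (unpickle j).
pose FX j := [set B | exists z, exists2 A, F (D j).2 A
                    & B = stone R (D j).1.1 (D j).1.2 z `&` f @^-1` A].
exists (\bigcup_j FX j).
  move=> x U oU Ux; have [k [P [oP Pfx PU]]] := genX (open_nbhs_nbhs (conj oU Ux)).
  have [A NA [Ax AP]] := netN _ _ oP Pfx.
  (* Level [k.+1], because two points of one [E k.+1 z] are [E k]-close. *)
  have [m [z xz]] := stone_cover k.+1 x woR.
  move: NA; rewrite NF => -[n _ FA].
  exists (stone R k.+1 m z `&` f @^-1` A).
    by exists (pickle (k.+1, m, n)) => //; exists z, A => //; rewrite /D pickleK.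
  split=> // y [[yz _] Ay]; apply: PU; split; last exact: AP.
  have zx : E k.+1 z x by case: xz => + _; apply; exact: uniformity_refl.
  apply: (uniformity_split unifE) (uniformity_sym unifE zx) _.
  by apply: yz; exact: uniformity_refl.
exists FX => // j x; rewrite /FX; case: (D j) => -[k m] n /=.
have [V xV Vdisc] := discF n (f x).
(* Two points of [E m.+2 x] are [E m.+1]-close, as [stone_separated] demands. *)
exists (E m.+2 x `&` f @^-1` V).
  by apply: filterI; [exact: uniformity_nbhs | exact: contf].
move=> _ _ [z [A FA ->]] [z' [A' FA' ->]].
move=> [y [[yz Ay] [xy Vy]]] [y' [[y'z' A'y'] [xy' Vy']]].
have -> : A = A' by apply: Vdisc => //; [exists (f y) | exists (f y')].
suff -> : z = z' by [].
apply: (stone_separated woR yz y'z').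
exact: (uniformity_split unifE) (uniformity_sym unifE xy) xy'.
Qed.

End Transfer.

Local Open Scope gyro_scope.

(** * Cancellation laws and left entourages in a gyrogroup *)

Section GyrogroupTheory.
Context (G : gyrogroupType).
Implicit Types (a b x y z : G) (V W H : set G).

(** Adding [⊖ a] on the left turns [a ⊕ b] into [gyr[⊖ a, a] b], and gyrations are injective. *)
Lemma gyroadd_left_inj a : injective (gyroadd a).
Proof.
move=> b c abc; apply: (bij_inj (gyr_bij (⊖ a) a)).
by have := gyroaddA (⊖ a) a c; rewrite -abc gyroaddA gyroaddNl !gyroadd0l.
Qed.

Lemma gyr0l a b : gyr[gyrozero, a] b = b.
Proof.
by apply: (@gyroadd_left_inj a); rewrite -{1}(gyroadd0l a) -gyroaddA gyroadd0l.
Qed.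

Lemma gyroaddKl a b : ⊖ a ⊕ (a ⊕ b) = b.
Proof. by rewrite gyroaddA -gyr_loop gyroaddNl gyr0l gyroadd0l. Qed.

Lemma gyrooppK a : ⊖ ⊖ a = a.
Proof. by apply/esym/gyroopp_uniq; rewrite (gyroaddNl, gyroaddNr). Qed.

Lemma gyroaddNKl a b : a ⊕ (⊖ a ⊕ b) = b.
Proof. by rewrite -{1}(gyrooppK a) gyroaddKl. Qed.

Lemma gyroopp_diff x y : ⊖ (⊖ x ⊕ y) = gyr[⊖ x, y] (⊖ y ⊕ x).
Proof.
apply: (@gyroadd_left_inj (⊖ x ⊕ y)).
by rewrite -gyroaddA gyroaddNKl gyroaddNl gyroaddNr.
Qed.

Lemma gyroadd_diff x y z : ⊖ x ⊕ z = (⊖ x ⊕ y) ⊕ gyr[⊖ x, y] (⊖ y ⊕ z).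
Proof. by rewrite -gyroaddA gyroaddNKl. Qed.

(** Differences invert and compose only up to a gyration, as the two preceding lemmas show;
    invariance absorbs it. *)
Definition gyr_invariant V := forall x y, gyr[x, y] @` V = V.

Lemma gyr_invariantP V x y z : gyr_invariant V -> V (gyr[x, y] z) <-> V z.
Proof.
move=> invV; split=> [|Vz]; last by rewrite -(invV x y); exists z.
rewrite -{1}(invV x y) => -[w Vw /(bij_inj (gyr_bij x y)) <- //].
Qed.

Lemma symmetric_setP V x : symmetric_set V -> V (⊖ x) <-> V x.
Proof.
move=> symV; split=> [|Vx]; last by rewrite -symV; exists x.
by rewrite -{1}symV => -[y Vy xy]; rewrite -(gyrooppK x) -xy gyrooppK.
Qed.

Definition left_entourage V x : set G := [set y | V (⊖ x ⊕ y)].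

Lemma left_entourage_sym V x y : symmetric_set V -> gyr_invariant V ->
  left_entourage V x y -> left_entourage V y x.
Proof.
move=> symV invV Vxy; apply/(gyr_invariantP (⊖ x) y _ invV).
by rewrite -gyroopp_diff; apply/symmetric_setP.
Qed.

Lemma left_entourage_comp V W x y z : gyr_invariant W ->
  left_entourage V x y -> left_entourage W y z ->
  left_entourage (set_gyroadd V W) x z.
Proof.
move=> invW Vxy Wyz; rewrite /left_entourage/= (gyroadd_diff x y).
exists (⊖ x ⊕ y) => //; exists (gyr[⊖ x, y] (⊖ y ⊕ z)) => //.
exact/gyr_invariantP.
Qed.

End GyrogroupTheory.

(** * Subspaces and points of metrizable spaces *)

Lemma nbhs_set_type (T : topologicalType) (A : set T) (x : set_type A) U :
  nbhs x U -> exists2 W, nbhs (set_val x) W & set_val @^-1` W `<=` U.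
Proof.
move=> [_ /= [[W oW <-] /= Wx sWU]]; exists W => //.
exact: open_nbhs_nbhs.
Qed.

Lemma set_type_hausdorff (T : topologicalType) (A : set T) :
  hausdorff_space T -> hausdorff_space (set_type A).
Proof.
move=> hT x y xy; apply: val_inj; apply: hT => B C xB yC.
have [z [Bz Cz]] : (set_val @^-1` B : set (set_type A)) `&` set_val @^-1` C !=set0.
  by apply: xy; exact: (@initial_continuous _ _ (@set_val _ A)).
by exists (set_val z).
Qed.

Lemma metrizable_singleton_Gdelta (R : realType) (T : topologicalType) (x : T) :
  metrizable R T ->
  exists O : nat -> set T,
    (forall n, nbhs x (O n)) /\ \bigcap_n O n `<=` [set x].
Proof.
move=> [M [f [g [fK gK cf cg]]]].
exists (fun n => f @^-1` ball (f x) (n.+1%:R^-1)%R); split.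
  by move=> n; apply: cf; exact: nbhsx_ballx.
(* By Hausdorffness it suffices that neighbourhoods of [f x] and [f y] meet; [f y] is a common
   point, lying in every ball around [f x]. *)
move=> y xy; apply: (can_inj fK); apply/esym/metric_hausdorff => A B.
move=> /nbhs_ballP[e /= e0 eA] /nbhs_singleton yB.
exists (f y); split => //; apply: eA.
have [n ne] : exists n, (n.+1%:R^-1 < e :> R)%R.
  by have [n _ /(_ n (leqnn n))] := near_infty_natSinv_lt (PosNum e0); exists n.
apply: (@le_ball _ _ (f x) (n.+1%:R^-1)%R); first exact: Order.POrderTheory.ltW.
exact: xy.
Qed.

(** * Uniformities on a strongly topological gyrogroup *)

Section StronglyTopological.
Context (G : topologicalGyrogroupType).
Implicit Types (x y z : G) (V W H : set G).

Lemma left_entourage_coset H x : left_entourage H x = gyrocoset H x.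
Proof.
apply/seteqP; split=> [y Hxy|_ [h Hh <-]]; last first.
  by rewrite /left_entourage/= gyroaddKl.
by exists (⊖ x ⊕ y) => //; rewrite gyroaddNKl.
Qed.

Lemma subgyrogroup0 H : subgyrogroup H -> H gyrozero.
Proof.
by move=> [[a Ha] HN HD]; rewrite -(gyroaddNl a); apply: HD => //; exact: HN.
Qed.

Lemma subgyrogroup_sym H : subgyrogroup H -> symmetric_set H.
Proof.
move=> [_ HN _]; apply/seteqP; split=> [_ [a Ha <-]|a Ha]; first exact: HN.
by exists (⊖ a); [exact: HN|rewrite gyrooppK].
Qed.

(** Under these hypotheses [left_entourage H] is an equivalence relation whose classes are the
    cosets. *)
Lemma gyrocoset_eqP H x y : subgyrogroup H -> gyr_invariant H ->
  gyrocoset H x = gyrocoset H y <-> left_entourage H x y.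
Proof.
move=> subH invH; have symH := subgyrogroup_sym subH.
have comp a b c : left_entourage H a b -> left_entourage H b c ->
    left_entourage H a c.
  move=> ab bc; have [h Hh [k Hk hk]] := left_entourage_comp invH ab bc.
  by rewrite /left_entourage/= -hk; case: subH => _ _; exact.
rewrite -!left_entourage_coset; split=> [->|xy].
  by rewrite /left_entourage/= gyroaddNl; exact: subgyrogroup0.
apply/seteqP; split=> z; apply: comp => //.
exact: left_entourage_sym.
Qed.

Lemma gyroadd_near x y U : nbhs (x ⊕ y) U ->
  exists A B, [/\ nbhs x A, nbhs y B & forall a b, A a -> B b -> U (a ⊕ b)].
Proof.
move=> /(@gyroadd_continuous G (x, y))[[A B] /= [xA yB] ABU].
by exists A, B; split => // a b Aa Bb; exact: (ABU (a, b)).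
Qed.

Lemma gyroaddl_near x y U : nbhs (x ⊕ y) U -> \forall z \near y, U (x ⊕ z).
Proof.
move=> /gyroadd_near[A [B [xA yB ABU]]]; apply: filterS yB => z; apply: ABU.
exact: nbhs_singleton.
Qed.

Lemma gyroaddr_near x y U : nbhs (x ⊕ y) U -> \forall z \near x, U (z ⊕ y).
Proof.
move=> /gyroadd_near[A [B [xA yB ABU]]]; apply: filterS xA => z /ABU; apply.
exact: nbhs_singleton.
Qed.

Lemma nbhs_left_entourage V x : nbhs gyrozero V -> nbhs x (left_entourage V x).
Proof. by rewrite -(gyroaddNl x) => /gyroaddl_near. Qed.

Lemma open_left_entourage V x : open V -> open (left_entourage V x).
Proof.
rewrite !openE => oV y /oV; exact: gyroaddl_near.
Qed.

Section StrongBase.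
Context (UU : set (set G)) (strongG : strongly_topological UU).

Lemma strong_nbhs V : UU V -> nbhs gyrozero V.
Proof. by case: strongG => + _ _ _; exact. Qed.

Lemma strong_sym V : UU V -> symmetric_set V.
Proof. by case: strongG => _ _ + _; exact. Qed.

Lemma strong_gyr_invariant V : UU V -> gyr_invariant V.
Proof. by case: strongG => _ _ _; exact. Qed.

Lemma strong_base W : nbhs gyrozero W -> exists2 V, UU V & V `<=` W.
Proof. by case: strongG => _ + _ _; exact. Qed.

Lemma strong_split W : nbhs gyrozero W ->
  exists2 V, UU V & set_gyroadd V V `<=` W.
Proof.
rewrite -{1}(gyroadd0l gyrozero) => /gyroadd_near[A [B [oA oB ABW]]].
have [V UV VAB] := strong_base (filterI oA oB).
by exists V => // _ [a /VAB[Aa _]] [b /VAB[_ Bb] <-]; exact: ABW.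
Qed.

Lemma admissible_gyr_invariant H : admissible_subgyrogroup UU H -> gyr_invariant H.
Proof.
move=> [_ [U [_ UU_U _ ->]]] x y; apply/seteqP; split=> [_ [z Uz <-] n _|z Uz].
  by apply/(gyr_invariantP x y z (strong_gyr_invariant (UU_U n)))/Uz.
have [g gK Kg] := gyr_bij x y.
exists (g z); last exact: Kg.
move=> n _; apply/(gyr_invariantP x y _ (strong_gyr_invariant (UU_U n))).
by rewrite Kg; exact: Uz.
Qed.

Lemma strong_uniformity (V : nat -> set G) : (forall n, UU (V n)) ->
  (forall n, set_gyroadd (V n.+1) (V n.+1) `<=` V n) ->
  uniformity_sequence (fun n => left_entourage (V n)).
Proof.
move=> UV VV; split=> [n x|n x y|n x y z xy yz].
- exact/nbhs_left_entourage/strong_nbhs.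
- by apply: left_entourage_sym; [exact: strong_sym|exact: strong_gyr_invariant].
- have invV := strong_gyr_invariant (UV n.+1).
  exact/VV/(left_entourage_comp invV xy yz).
Qed.

Lemma admissible_uniformity (R : realType) H :
  admissible_subgyrogroup UU H -> metrizable R (set_type H) ->
  exists V : nat -> set G, [/\ forall n, UU (V n),
    forall n, set_gyroadd (V n.+1) (V n.+1) `<=` V n
    & \bigcap_n V n `<=` [set gyrozero]].
Proof.
move=> [subH [U [nU UU_U _ HU]]] metrH.
have H0 := subgyrogroup0 subH.
pose z0 : set_type H := SigSub (mem_set H0).
have [B [nB capB]] := metrizable_singleton_Gdelta z0 metrH.
have /choice[W nW] : forall n, exists W,
      nbhs (gyrozero : G) W /\ set_val @^-1` W `<=` B n.
    by move=> n; have [W] := nbhs_set_type (nB n); exists W.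
(* One step of the recursion, from (n, V_n) to V_{n+1}. The premise [UU p.2] sits under the
   existential so that [choice] yields a total function; [setT] is a dummy value. *)
have next (p : nat * set G) : exists V', UU p.2 ->
    [/\ UU V', V' `<=` U p.1 `&` W p.1 & set_gyroadd V' V' `<=` p.2].
  have [Up|nUp] := pselect (UU p.2); last by exists setT.
  have [V1 UV1 V1p] := strong_split (strong_nbhs Up).
  have nUW : nbhs gyrozero (U p.1 `&` W p.1 `&` V1).
    apply: filterI; last exact: strong_nbhs.
    by apply: filterI; [exact/strong_nbhs/UU_U|case: (nW p.1)].
  have [V2 UV2 V2sub] := strong_base nUW.
  exists V2 => _; split=> // [v /V2sub[] //|_ [a /V2sub[_ V1a]] [b /V2sub[_ V1b] <-]].
  by apply: V1p; exists a => //; exists b.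
have [g gP] := choice next.
have [V0 UV0 _] := strong_base (@filterT _ (nbhs (gyrozero : G)) _).
pose V := fix V n := if n is m.+1 then g (m, V m) else V0.
have UV n : UU (V n).
  by elim: n => //= n IHn; have [] := gP (n, V n) IHn.
(* V_{n+1} lies in both [U n] and [W n]: the sets [U n] force [x] into [H], and then the traces of
   the [W n] on [H] force [x] to be [gyrozero]. *)
exists V; split=> [//|n|x Vx]; first by have [] := gP (n, V n) (UV n).
have UWx n : U n x /\ W n x.
  by have [_ + _] := gP (n, V n) (UV n); apply; exact: (Vx n.+1).
have Hx : H x by rewrite HU => n _; case: (UWx n).
have /capB /(congr1 val) // : (\bigcap_n B n) (SigSub (mem_set Hx)).
by move=> n _; apply: (nW n).2; case: (UWx n).
Qed.

End StrongBase.
End StronglyTopological.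

(** * The coset projection and local generation of the topology *)

Section LocalGeneration.
Local Open Scope quotient_scope.
Context (G : topologicalGyrogroupType) (H : set G).
Hypotheses (subH : subgyrogroup H) (invH : gyr_invariant H).

Definition gyrocoset_pi (x : G) : gyrocoset_space H := \pi_(gyrocoset_space H) x.

Lemma gyrocoset_piP x y :
  gyrocoset_pi x = gyrocoset_pi y <-> left_entourage H x y.
Proof.
rewrite -gyrocoset_eqP //.
by split=> [/(@eqmodP _ (gyrocoset_equiv H))/asboolP
          |/asboolP/(@eqmodP _ (gyrocoset_equiv H))].
Qed.

Lemma gyrocoset_pi_continuous : continuous gyrocoset_pi.
Proof. exact: pi_continuous. Qed.

(** If [y] shares the coset of [a] in [A], then for [y'] near [y] the right translate
    [y' ⊕ (⊖ y ⊕ a)] is still in [A], and it is in the coset of [y'] because [⊖ y ⊕ a] is in [H]. *)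
Lemma gyrocoset_pi_open A : open A -> open (gyrocoset_pi @` A).
Proof.
move=> oA; rewrite -[open _]/(open (gyrocoset_pi @^-1` (gyrocoset_pi @` A))).
rewrite openE => y [a Aa /esym/gyrocoset_piP ya]; rewrite /interior.
have : nbhs (y ⊕ (⊖ y ⊕ a)) A by rewrite gyroaddNKl; exact: open_nbhs_nbhs.
move=> /gyroaddr_near; apply: filterS => y' Ay'.
exists (y' ⊕ (⊖ y ⊕ a)) => //; apply/esym/gyrocoset_piP.
by rewrite /left_entourage/= gyroaddKl.
Qed.

(* If [y] and [z] are both [B]-close to [x] and [y] lies in the coset of
   [z ⊕ w] with [w] in [B], then [y = z ⊕ (w ⊕ h)] where [h] is forced into the
   compact set [K]; hence the claim only has to be checked near each [h] in [K]. *)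
Lemma local_generation (V : nat -> set G) (B K O : set G) (x : G) :
    uniformity_sequence (fun n => left_entourage (V n)) ->
    \bigcap_n V n `<=` [set gyrozero] ->
    compact K -> O `&` H `<=` K ->
    nbhs gyrozero B -> symmetric_set B -> gyr_invariant B ->
    set_gyroadd B (set_gyroadd B B) `<=` O ->
  forall z U, left_entourage B x z -> nbhs z U -> exists n P,
    [/\ open P, P (gyrocoset_pi z) &
      left_entourage B x `&` left_entourage (V n) z `&` gyrocoset_pi @^-1` P
        `<=` U].
Proof.
move=> unifV capV cK OHK nB symB invB BBO z U xz zU.
pose E n := left_entourage (V n).
have zadd h (Q : set G) : nbhs (z ⊕ h) Q ->
    \forall h' \near h & w \near (gyrozero : G), Q (z ⊕ (w ⊕ h')).
  move=> /gyroaddl_near; rewrite -{1}(gyroadd0l h) => /gyroadd_near.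
  move=> [A [C [nA nC ACQ]]]; exists (C, A) => // -[h' w] [/= Ch' Aw].
  exact: ACQ.
(* Compactness of [K] makes the choice of a neighbourhood of [gyrozero] and of an index uniform in
   [h]. *)
have : \forall i \near filter_prod (nbhs (gyrozero : G)) \oo,
    K `<=` (fun h => E i.2 z (z ⊕ (i.1 ⊕ h)) -> U (z ⊕ (i.1 ⊕ h))).
  move/compact_near_coveringP: cK => /(_ _ (filter_prod (nbhs (gyrozero : G)) \oo)
    (fun i h => E i.2 z (z ⊕ (i.1 ⊕ h)) -> U (z ⊕ (i.1 ⊕ h)))).
  apply=> h _.
  (* Near [h = gyrozero] the points [z ⊕ (w ⊕ h)] are in [U]. Any other [h] has [z ⊕ h] outside some
     [E N z], and then nearby points are outside [E n z] for all [n > N], so the implication is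
     vacuous. *)
  have [->|h0] := eqVneq h gyrozero.
    have /zadd[[A C] /= [nA nC] ACU] : nbhs (z ⊕ gyrozero) U by rewrite gyroadd0r.
    exists (A, C `*` setT) => /=.
      by split=> //; exists (C, setT) => //=; split => //; exact: filterT.
    by move=> [h' [w n]] /= [Ah' [Cw _]] _; exact: (ACU (h', w)).
  have [N nEN] : exists N, ~ E N z (z ⊕ h).
    apply: contrapT => /forallNP hN; move/eqP: h0; apply; apply: capV => n _.
    by have /contrapT := hN n; rewrite /E /left_entourage/= gyroaddKl.
  have /zadd[[A C] /= [nA nC] ACE] := uniformity_nbhs unifV N.+1 (z ⊕ h).
  exists (A, C `*` [set n | (N < n)%N]) => /=.
    split=> //; exists (C, [set n | (N < n)%N]) => //=; split => //.
    by exists N.+1.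
  move=> [h' [w n]] /= [Ah' [Cw Nn]] /(uniformity_le unifV Nn) zE; case: nEN.
  have Eh := ACE (h', w) (conj Ah' Cw).
  exact: (uniformity_split unifV) zE (uniformity_sym unifV Eh).
move=> [[W I] /= [nW [N _ NI]] WIK].
(* [W] serves the uniform choice, [B] will confine [h] to [K], and the interior makes the image in
   the quotient open. *)
pose W' := (W `&` B)°.
have nW' : nbhs gyrozero W' by apply/nbhs_interior/filterI.
exists N, (gyrocoset_pi @` left_entourage W' z); split.
- exact/gyrocoset_pi_open/open_left_entourage/open_interior.
- by exists z => //; exact: nbhs_singleton (nbhs_left_entourage _ nW').
move=> y [[xy zy] [a za /gyrocoset_piP ay]].
have [Wa Ba] := interior_subset za.
set w := ⊖ z ⊕ a in Wa Ba.
(* Undoing the gyration by [g] turns [y = a ⊕ (⊖ a ⊕ y)], with [a = z ⊕ w], into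
   [y = z ⊕ (w ⊕ h)]. *)
have [g gK Kg] := gyr_bij z w.
pose h := g (⊖ a ⊕ y).
have Hh : H h by apply/(gyr_invariantP z w _ invH); rewrite Kg.
have yE : z ⊕ (w ⊕ h) = y by rewrite gyroaddA Kg !gyroaddNKl.
(* Here [h = ⊖ w ⊕ (w ⊕ h)], and [w ⊕ h = ⊖ z ⊕ y] is in [B ⊕ B] because [z] and [y] are both
   [B]-close to [x]. *)
have Kh : K h.
  apply: OHK; split=> //; apply: BBO; rewrite -(gyroaddKl w h).
  exists (⊖ w); first exact/symmetric_setP.
  exists (w ⊕ h) => //; rewrite -(gyroaddKl z (w ⊕ h)) yE.
  exact: left_entourage_comp (left_entourage_sym symB invB xz) xy.
have := WIK (w, N) (conj Wa (NI N (leqnn N))) h Kh.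
by rewrite /= yE; exact.
Qed.

End LocalGeneration.

(** * Local compactness of the subgyrogroup and assembly of the proof *)

Lemma locally_compact_trace (G : topologicalType) (H : set G) (a : G) :
  locally_compact [set: set_type H] -> H a ->
  exists K W : set G, [/\ compact K, nbhs a W & W `&` H `<=` K].
Proof.
move=> lcH Ha; pose a' : set_type H := SigSub (mem_set Ha).
have [C + [cC _]] := lcH a' I; rewrite withinET => /nbhs_set_type[W nW WC].
exists (set_val @` C), W; split => //.
  apply: continuous_compact => //; apply: continuous_subspaceT.
  exact: initial_continuous.
move=> h [Wh Hh]; exists (SigSub (mem_set Hh)) => //.
exact: WC.
Qed.

Theorem corollary4p12 (R : realType) (G : topologicalGyrogroupType)
    (UU : set (set G)) (H : set G)
    (hausdorffG : hausdorff_space G)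
    (strongG : strongly_topological UU)
    (admH : admissible_subgyrogroup UU H)
    (lcptH : locally_compact [set: set_type H])
    (metrH : metrizable R (set_type H)) :
  [/\ stratifiable_space (gyrocoset_space H) -> local_space stratifiable_space G,
      semi_stratifiable_space (gyrocoset_space H) ->
        local_space semi_stratifiable_space G
    & sigma_space (gyrocoset_space H) -> local_space sigma_space G].
Proof.
have subH : subgyrogroup H := admH.1.
have invH := admissible_gyr_invariant strongG admH.
have [V [UV VV capV]] := admissible_uniformity strongG admH metrH.
have unifV := strong_uniformity strongG UV VV.
have [K [W [cK nW WHK]]] := locally_compact_trace lcptH (subgyrogroup0 subH).
(* Two halvings of [W] make room for the triple sum of [B] required by [local_generation]. *)
have [B0 UB0 B0W] := strong_split strongG nW.
have [B1 UB1 B1B0] := strong_split strongG (strong_nbhs strongG UB0).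
have [B UB BB01] := strong_base strongG
  (filterI (strong_nbhs strongG UB0) (strong_nbhs strongG UB1)).
have nB := strong_nbhs strongG UB.
have BBW : set_gyroadd B (set_gyroadd B B) `<=` W.
  move=> _ [a /BB01[B0a _] [_ [b /BB01[_ B1b] [c /BB01[_ B1c] <-]] <-]].
  apply: B0W; exists a => //; exists (b ⊕ c) => //.
  by apply: B1B0; exists b => //; exists c.
pose F x := left_entourage B x.
pose p x := @gyrocoset_pi G H \o @set_val G (F x).
pose E x n (y : set_type (F x)) : set (set_type (F x)) :=
  set_val @^-1` left_entourage (V n) (set_val y).
have val_cont x : continuous (@set_val G (F x)) by exact: initial_continuous.
have pcont x : continuous (p x).
  move=> y; apply: continuous_comp; first exact: val_cont.
  exact: gyrocoset_pi_continuous.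
have Eunif x : uniformity_sequence (E x).
  split=> [n y|n y z|n y z t].
  - by apply: val_cont; exact: (uniformity_nbhs unifV).
  - exact: (uniformity_sym unifV).
  - exact: (uniformity_split unifV).
have Egen x : jointly_generates (p x) (E x).
  move=> z U /nbhs_set_type[Q zQ QU].
  have [n [P [oP Pz PQ]]] := local_generation subH invH unifV capV cK WHK nB
    (strong_sym strongG UB) (strong_gyr_invariant strongG UB) BBW (set_valP z) zQ.
  exists n, P; split => // y [zy Py]; apply: QU; apply: PQ; split => //.
  by split => //; exact: set_valP.
have hF x : hausdorff_space (set_type (F x)) by exact: set_type_hausdorff.
have nF x : nbhs x (F x) by exact: nbhs_left_entourage.
split=> spY x; exists (F x) => //.
- exact: (stratifiable_transfer (Eunif x) (pcont x) (Egen x) (hF x) spY).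
- exact: (semi_stratifiable_transfer (Eunif x) (pcont x) (Egen x) (hF x) spY).
- exact: (sigma_transfer (Eunif x) (pcont x) (Egen x) (hF x) spY).
Qed.
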